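(* Let $n\ge 1$ be an integer and let $0<r_1<r_2$. For $0\le t<r_2-r_1$ let $B_1^t=B(t\mathbf{e}_1,r_1)$ and $B_2=B(\mathbf{0},r_2)$ in $\mathbb{R}^{n+2}$, and let $\sigma_1^t$ be the first Steklov--Dirichlet eigenvalue of the annulus $\Omega=B_2\setminus\overline{B_1^t}$, with the Dirichlet condition on $\partial B_1^t$ and the Steklov condition on $\partial B_2$. Then $$\liminf_{t\to (r_2-r_1)^-}\sigma_1^t\ \ge\ \frac{(n+1)r_1-nr_2}{2r_2(r_2-r_1)}.$$
   Context: $B(\mathbf{x},r)$ is the open ball in $\mathbb{R}^{n+2}$ with center $\mathbf{x}$ and radius $r$; $\mathbf{e}_1=(1,0,\dots,0)$. The radii $r_1,r_2$ are fixed; since $0\le t<r_2-r_1$, $\overline{B_1^t}\subset B_2$. A Steklov--Dirichlet eigenvalue of $\Omega=B_2\setminus\overline{B_1^t}$ is a real number $\sigma$ for which there is a non-trivial $u$ (an eigenfunction) with $\Delta u=0$ in $\Omega$, $u=0$ on $\partial B_1^t$, and $\frac{\partial u}{\partial\mathbf{n}}=\sigma u$ on $\partial B_2$, where $\mathbf{n}$ is the outward unit normal to $\partial\Omega$. The eigenvalues form a discrete sequence $0<\sigma_1\le\sigma_2\le\cdots\to\infty$, and $\sigma_1^t$ denotes the smallest one. Equivalently, $$\sigma_1^t=\inf\Big\{\int_\Omega|\nabla v|^2\,dx\ :\ v\in H^1(\Omega),\ v=0\text{ on }\partial B_1^t,\ \int_{\partial B_2}v^2\,dS=1\Big\}.$$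 *)

(* Defs.v *)
From HB Require Import structures.
From mathcomp Require Import all_boot all_order all_algebra.
From mathcomp Require Import all_classical all_reals all_analysis.

Set Implicit Arguments.
Unset Strict Implicit.
Unset Printing Implicit Defensive.

Import Order.TTheory GRing.Theory Num.Theory.
Import numFieldNormedType.Exports.

Local Open Scope classical_set_scope.
Local Open Scope ring_scope.

(* The library norm on 'rV[R]_m is the sup norm.  It induces the same topology
   (and the same continuity and derivatives) as the Euclidean norm, but its
   balls are cubes, so Euclidean balls have to be defined here. *)
Definition enorm (R : realType) (m : nat) (x : 'rV[R]_m) : R :=
  Num.sqrt (\sum_(i < m) x 0 i ^+ 2).

Definition eball (R : realType) (m : nat) (c : 'rV[R]_m) (r : R)
  : set 'rV[R]_m := [set x | enorm (x - c) < r].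

Definition boundary (T : topologicalType) (A : set T) : set T :=
  closure A `\` interior A.

Definition partial (R : realType) (m : nat) (i : 'I_m) (u : 'rV[R]_m -> R)
  : 'rV[R]_m -> R := fun x => 'D_(delta_mx 0 i) u x.

(* 'D_v is total, hence the explicit derivability conditions. *)
Definition class_C2 (R : realType) (m : nat) (Om : set 'rV[R]_m)
    (u : 'rV[R]_m -> R) : Prop :=
  forall x, Om x ->
    {for x, continuous u} /\
    (forall i : 'I_m, derivable u x (delta_mx 0 i) /\
                      {for x, continuous (partial i u)}) /\
    (forall i j : 'I_m, derivable (partial i u) x (delta_mx 0 j) /\
                        {for x, continuous (partial j (partial i u))}).

Definition laplacian (R : realType) (m : nat) (u : 'rV[R]_m -> R)
  : 'rV[R]_m -> R := fun x => \sum_(i < m) partial i (partial i u) x.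

Definition harmonic_on (R : realType) (m : nat) (Om : set 'rV[R]_m)
    (u : 'rV[R]_m -> R) : Prop :=
  class_C2 Om u /\ (forall x, Om x -> laplacian u x = 0).

(* The derivative of u at the boundary point x in the direction of the outward
   unit normal nu, taken from inside the domain: only the points x - s nu with
   s > 0 small are used, so the values of u outside the closed domain play no
   role. *)
Definition has_normal_derivative (R : realType) (m : nat) (u : 'rV[R]_m -> R)
    (x nu : 'rV[R]_m) (d : R) : Prop :=
  (u x - u (x - s *: nu)) / s @[s --> 0^'+] --> d.

Section SteklovDirichlet.
Variables (R : realType) (n : nat) (r1 r2 t : R).

Definition inner_ball : set 'rV[R]_(n.+2) := eball (t *: delta_mx 0 0) r1.

Definition outer_ball : set 'rV[R]_(n.+2) := eball 0 r2.

Definition annulus : set 'rV[R]_(n.+2) := outer_ball `\` closure inner_ball.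

(* Classical eigenfunctions, of class C^2 inside and continuous up to the
   boundary; (enorm x)^-1 *: x is the outward unit normal at a point x of the
   sphere bounding the outer ball. *)
Definition sd_eigenfunction (sigma : R) (u : 'rV[R]_(n.+2) -> R) : Prop :=
  [/\ exists2 x, annulus x & u x != 0,
      {within closure annulus, continuous u},
      harmonic_on annulus u,
      forall x, boundary inner_ball x -> u x = 0
    & forall x, boundary outer_ball x ->
        has_normal_derivative u x ((enorm x)^-1 *: x) (sigma * u x)].

Definition sd_eigenvalue (sigma : R) : Prop :=
  exists u, sd_eigenfunction sigma u.

(* For 0 < r1 and 0 <= t < r2 - r1 the set of eigenvalues has a least element,
   which is therefore the value of this infimum. *)
Definition first_sd_eigenvalue : \bar R :=
  ereal_inf [set sigma%:E | sigma in sd_eigenvalue].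

End SteklovDirichlet.

(* Main.v *)
Require Import Defs.
From mathcomp Require Import all_boot all_order all_algebra.
From mathcomp Require Import all_classical all_reals all_analysis.
From mathcomp Require Import ring lra.
Import Order.TTheory GRing.Theory Num.Theory.
Import numFieldNormedType.Exports.
Local Open Scope classical_set_scope.
Local Open Scope ring_scope.

(* The bound holds for every t in [0, r2 - r1[, by a Barta-type comparison with
   the harmonic function h(x) = r1^-n - |x - t e1|^-n, which vanishes on the
   inner sphere and is positive on the outer one.  For an eigenfunction u,
   positive somewhere on the outer sphere, let M be the maximum of u / h there,
   attained at p.  The weak maximum principle gives u <= M h in the annulus
   with equality at p, so the outward derivative of u - M h at p is nonnegative:
   sigma u(p) >= M h_n(p), that is sigma >= h_n(p) / h(p).  On the outer sphere
   h_n / h is smallest where |x - t e1| = r2 + t < 2 r2 - r1, and with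
   s = (r2 - r1) / r1 the remaining estimate is
   (1 + 2 s)^(n+1) (1 - n s) <= 1 + (n + 2) s. *)

Set Implicit Arguments.
Unset Strict Implicit.

(** * Directional derivatives and the second-order condition at a local maximum *)

(** Brings one-variable calculus (mean value theorem, vanishing derivative at a maximum) to bear on
    [f] along a line; the two difference quotients coincide. *)
Lemma is_derive_line (R : realType) (V W : normedModType R) (f : V -> W)
    (p v : V) (s : R) (d : W) :
  is_derive (s *: v + p) v f d -> is_derive s 1 (fun s => f (s *: v + p)) d.
Proof.
have E : (fun h : R => h^-1 *: (((fun s => f (s *: v + p)) \o shift s) (h *: 1)
      - f (s *: v + p)))
    = (fun h => h^-1 *: ((f \o shift (s *: v + p)) (h *: v) - f (s *: v + p))).
  by apply/funext => h /=; rewrite [h *: 1]mulr1 scalerDl addrA.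
move=> [fd <-]; split.
  by rewrite /derivable E.
by rewrite /derive E.
Qed.

(** The first derivative along [v] vanishes at [p]. Were the second one positive, the first would be
    positive just beyond [p], and the mean value theorem would push [f] above [f p]. *)
Lemma second_derivative_le0 (R : realType) (V : normedModType R) (f : V -> R)
    (p v : V) :
  (\forall y \near p, derivable f y v) -> derivable (derive f ^~ v) p v ->
  (\forall y \near p, f y <= f p) -> 'D_v (derive f ^~ v) p <= 0.
Proof.
move=> fd fdd fmax; rewrite leNgt; apply/negP => a0.
have lineP : (fun s : R => s *: v + p) @ 0 --> p.
  rewrite -[X in _ --> X]add0r -(scale0r v).
  apply: cvgD; last exact: cvg_cst.
  exact: scalel_continuous.
have : \forall s \near (0 : R),
    derivable f (s *: v + p) v /\ f (s *: v + p) <= f p.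
  exact: (lineP _ (filterI fd fmax)).
case=> e /= e0 He.
have gd (s : R) : `|s| < e ->
    is_derive s 1 (fun s : R => f (s *: v + p)) ('D_v f (s *: v + p)).
  move=> se; apply: is_derive_line; apply: derivableP; apply (He s).
  by rewrite /= sub0r normrN.
have itvE (s : R) : s \in `]-e, e[ -> `|s| < e by rewrite in_itv/= ltr_norml.
have Dp0 : 'D_v f p = 0.
  have := gd 0; rewrite normr0 => /(_ e0) [_].
  rewrite scale0r add0r => <-.
  apply: (@derive_val _ _ _ _ _ _ _ (@derive1_at_max _ _ (-e) e 0 _ _ _ _)).
  - by rewrite ge0_cp ?ltW.
  - by move=> t /itvE /gd [].
  - by rewrite in_itv /= oppr_lt0 e0.
  - move=> t /itvE te; rewrite scale0r add0r; apply: (He t _).2.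
    by rewrite /= sub0r normrN.
have [d /= d0 Hd] : \forall h \near (0 : R)^',
    0 < h^-1 *: ((derive f ^~ v \o shift p) (h *: v) - 'D_v f p).
  exact: (cvgr_gt _ fdd).
(* Half the minimum, so that the segment up to [b] stays strictly inside both neighbourhoods. *)
set b := Num.min e d / 2.
have m0 : 0 < Num.min e d by rewrite lt_min e0.
have b0 : 0 < b by rewrite divr_gt0.
have be : b < e by rewrite ltr_pdivrMr// (@le_lt_trans _ _ e)// ?ge_min ?lexx// mulr_natr mulr2n ltrDl.
have bd : b < d by rewrite ltr_pdivrMr// (@le_lt_trans _ _ d)// ?ge_min ?lexx ?orbT// mulr_natr mulr2n ltrDl.
have [] := @MVT _ (fun s => f (s *: v + p)) (fun s => 'D_v f (s *: v + p)) 0 b b0.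
- move=> x /[!in_itv]/= /andP[x0 xb]; apply: gd.
  by rewrite gtr0_norm// (lt_trans xb).
- apply: derivable_within_continuous => x /[!in_itv]/= /andP[x0 xb].
  have [] // := gd x; by rewrite ger0_norm// (le_lt_trans xb).
move=> c /[!in_itv]/= /andP[c0 cb]; rewrite scale0r add0r subr0 => E.
have : f (b *: v + p) <= f p.
  by apply (He b); rewrite /= sub0r normrN gtr0_norm.
rewrite -subr_le0 E leNgt mulr_gt0//.
have := Hd c; rewrite /= sub0r normrN (gtr0_norm c0) (lt_trans cb)// gt_eqF//.
move=> /(_ isT isT).
by rewrite Dp0 subr0 pmulr_rgt0// invr_gt0.
Unshelve. all: by end_near. Qed.

Lemma is_derive_addZ (R : realType) (V : normedModType R) (f g : V -> R)
    (k a b : R) (x v : V) :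
  is_derive x v f a -> is_derive x v g b ->
  is_derive x v (fun y => f y + k * g y) (a + k * b).
Proof.
move=> df dg.
have dk := @is_deriveZ R V R^o g k x v b dg.
exact: (@is_deriveD R V R^o _ _ x v _ _ df dk).
Qed.

Lemma is_derive2_addZ (R : realType) (V : normedModType R) (f g : V -> R)
    (k : R) (x v : V) :
  (\forall y \near x, derivable f y v) -> (\forall y \near x, derivable g y v) ->
  derivable (derive f ^~ v) x v -> derivable (derive g ^~ v) x v ->
  is_derive x v (derive (fun y => f y + k * g y) ^~ v)
    (derive (derive f ^~ v) x v + k * derive (derive g ^~ v) x v).
Proof.
move=> df dg /derivableP ddf /derivableP ddg.
have E : \forall y \near x, 'D_v f y + k * 'D_v g y = 'D_v (fun y => f y + k * g y) y.
  apply: filterS2 df dg => y /derivableP fy /derivableP gy; apply/esym.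
  by case: (is_derive_addZ k fy gy).
exact: (@near_eq_is_derive R V R^o _ _ _ _ _ E (is_derive_addZ k ddf ddg)).
Qed.

(** * The squared Euclidean distance and its real powers *)

(** The square is kept because it is a polynomial, differentiable even at [c]; Euclidean balls are
    its sublevel sets. *)
Definition sqdist (R : realType) (m : nat) (c x : 'rV[R]_m) : R :=
  \sum_(i < m) (x 0 i - c 0 i) ^+ 2.

Lemma enormE (R : realType) (m : nat) (c x : 'rV[R]_m) :
  enorm (x - c) = Num.sqrt (sqdist c x).
Proof. by rewrite /enorm /sqdist; under eq_bigr do rewrite !mxE. Qed.

Lemma sqdist_ge0 (R : realType) (m : nat) (c x : 'rV[R]_m) : 0 <= sqdist c x.
Proof. by apply: sumr_ge0 => i _; exact: sqr_ge0. Qed.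

Lemma differentiable_sqdist (R : realType) (m : nat) (c x : 'rV[R]_m) :
  differentiable (sqdist c) x.
Proof.
suff : differentiable
    (\sum_(i < m) (fun y : 'rV[R]_m => (y 0 i - c 0 i) * (y 0 i - c 0 i))) x.
  congr (differentiable _ x).
  by apply/funext => y; rewrite fct_sumE; apply: eq_bigr => i _; rewrite expr2.
apply: differentiable_sum => i.
have d : differentiable (fun y : 'rV[R]_m => y 0 i - c 0 i) x.
  apply: (@differentiableB R _ R^o (fun y : 'rV[R]_m => y 0 i) (cst (c 0 i))).
    exact: differentiable_coord.
  exact: differentiable_cst.
exact: differentiableM.
Qed.

Lemma sqdist_continuous (R : realType) (m : nat) (c : 'rV[R]_m) :
  continuous (sqdist c).
Proof.
by move=> x; exact: differentiable_continuous (differentiable_sqdist c x).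
Qed.

Lemma is_derive_coordB (R : realType) (m : nat) (i : 'I_m) (b : R)
    (x v : 'rV[R]_m) : is_derive x v (fun y : 'rV[R]_m => y 0 i - b) (v 0 i).
Proof.
have E : (fun h : R => h^-1 *: (((fun y : 'rV[R]_m => y 0 i - b) \o shift x) (h *: v)
    - (x 0 i - b))) @ 0^' --> v 0 i.
  apply: (@cvg_trans _ (cst (v 0 i) @ (0:R)^')); last exact: cvg_cst.
  apply: near_eq_cvg; near=> h => /=.
  rewrite !mxE opprB addrA subrK addrK /GRing.scale/= mulKf//.
  by near: h; exact: nbhs_dnbhs_neq.
apply: DeriveDef; last exact: (cvg_lim _ E).
exact: (cvgP _ E).
Unshelve. all: by end_near. Qed.

Lemma is_derive_sqdist (R : realType) (m : nat) (c x v : 'rV[R]_m) :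
  is_derive x v (sqdist c) (2 * \sum_(i < m) (x 0 i - c 0 i) * v 0 i).
Proof.
suff : is_derive x v
    (\sum_(i < m) (fun y : 'rV[R]_m => (y 0 i - c 0 i) * (y 0 i - c 0 i)))
    (\sum_(i < m) 2 * ((x 0 i - c 0 i) * v 0 i)).
  rewrite -mulr_sumr; congr (is_derive x v _ _).
  by apply/funext => y; rewrite fct_sumE; apply: eq_bigr => i _; rewrite expr2.
apply: is_derive_sum => i.
have d := is_derive_coordB i (c 0 i) x v.
apply: is_derive_eq (is_deriveM d d) _.
rewrite /GRing.scale/=; ring.
Qed.

Lemma partial_sqdist (R : realType) (m : nat) (i : 'I_m) (c : 'rV[R]_m) :
  partial i (sqdist c) = (fun y => 2 * (y 0 i - c 0 i)).
Proof.
apply/funext => y; rewrite /partial.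
have [_ ->] := is_derive_sqdist c y (delta_mx 0 i).
congr (_ * _); rewrite (bigD1 i)//= big1 => [|j /negPf ji].
  by rewrite mxE !eqxx mulr1 addr0.
by rewrite mxE ji andbF mulr0.
Qed.

Lemma is_derive_partial_sqdist (R : realType) (m : nat) (i : 'I_m)
    (c x : 'rV[R]_m) :
  is_derive x (delta_mx 0 i) (partial i (sqdist c)) 2.
Proof.
rewrite partial_sqdist.
have d := is_derive_coordB i (c 0 i) x (delta_mx 0 i).
apply: is_derive_eq (is_deriveM (is_derive_cst (2 : R^o) _ _) d) _.
by rewrite mxE !eqxx scaler0 addr0 [LHS]mulr1.
Qed.

Lemma is_derive_comp1 (R : realType) (V : normedModType R) (f : V -> R)
    (g : R -> R) (x v : V) (a b : R) :
  differentiable f x -> is_derive x v f a -> is_derive (f x) 1 g b ->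
  is_derive x v (fun y => g (f y)) (b * a).
Proof.
move=> df [_ fa] [dg gb].
have {}dg : differentiable g (f x) by apply/derivable1_diffP.
have dgf : differentiable (g \o f) x by exact: differentiable_comp.
apply: DeriveDef; first exact: diff_derivable.
rewrite -[LHS]/('D_v (g \o f) x) (deriveE _ dgf) diff_comp//=.
by rewrite -(deriveE v df) fa (diff1E dg) derive1E gb [LHS]mulrC.
Qed.

Lemma is_derive_powR_sqdist (R : realType) (m : nat) (c x v : 'rV[R]_m) (a : R) :
  0 < sqdist c x ->
  is_derive x v (fun y => sqdist c y `^ a)
    (a * sqdist c x `^ (a - 1) * (2 * \sum_(i < m) (x 0 i - c 0 i) * v 0 i)).
Proof.
move=> q0; apply: is_derive_comp1 (is_derive1_powR a q0).
  exact: differentiable_sqdist.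
exact: is_derive_sqdist.
Qed.

Lemma partial_powR_sqdist (R : realType) (m : nat) (i : 'I_m) (c x : 'rV[R]_m)
    (a : R) : 0 < sqdist c x ->
  partial i (fun y => sqdist c y `^ a) x
    = a * sqdist c x `^ (a - 1) * (2 * (x 0 i - c 0 i)).
Proof.
move=> q0; rewrite /partial.
have [_ ->] := is_derive_powR_sqdist (delta_mx 0 i) a q0.
have := partial_sqdist i c => /(congr1 (fun f => f x)) <-.
by rewrite /partial; have [_ ->] := is_derive_sqdist c x (delta_mx 0 i).
Qed.

Lemma near_sqdist_gt (R : realType) (m : nat) (c x : 'rV[R]_m) (b : R) :
  b < sqdist c x -> \forall y \near x, b < sqdist c y.
Proof. exact: (cvgr_gt _ (@sqdist_continuous _ _ c x)). Qed.

Lemma is_derive_partial_powR_sqdist (R : realType) (m : nat) (i : 'I_m)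
    (c x : 'rV[R]_m) (a : R) : 0 < sqdist c x ->
  is_derive x (delta_mx 0 i) (partial i (fun y => sqdist c y `^ a))
    (2 * a * (sqdist c x `^ (a - 1)
      + 2 * (a - 1) * sqdist c x `^ (a - 2) * (x 0 i - c 0 i) ^+ 2)).
Proof.
move=> q0.
have E : \forall y \near x, (2 * a) * (sqdist c y `^ (a - 1) * (y 0 i - c 0 i))
    = partial i (fun y => sqdist c y `^ a) y.
  apply: filterS (near_sqdist_gt q0) => y qy.
  by rewrite partial_powR_sqdist//; ring.
have dp := is_derive_powR_sqdist (delta_mx 0 i) (a - 1) q0.
have d := is_derive_coordB i (c 0 i) x (delta_mx 0 i).
apply: (@near_eq_is_derive R _ R^o _ _ _ _ _ E).
apply: is_derive_eq
  (is_deriveM (is_derive_cst ((2 * a) : R^o) _ _) (is_deriveM dp d)) _.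
have := partial_sqdist i c => /(congr1 (fun f => f x)).
rewrite /partial; have [_ ->] := is_derive_sqdist c x (delta_mx 0 i) => ->.
rewrite mxE !eqxx /GRing.scale/= (_ : a - 1 - 1 = a - 2); last by ring.
ring.
Qed.

(** Summing the pure second derivatives turns the squared coordinates into [sqdist c x], which
    raises the power [a - 2] to [a - 1]. The coefficient vanishes when 2 a = 2 - m, the exponent of
    the fundamental solution. *)
Lemma laplacian_powR_sqdist (R : realType) (m : nat) (c x : 'rV[R]_m) (a : R) :
  0 < sqdist c x ->
  laplacian (fun y => sqdist c y `^ a) x
    = 2 * a * (m%:R + 2 * (a - 1)) * sqdist c x `^ (a - 1).
Proof.
move=> q0; rewrite /laplacian.
under eq_bigr => i _.
  rewrite {1}/partial.
  have [_ ->] := is_derive_partial_powR_sqdist i a q0.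
  over.
rewrite -mulr_sumr big_split/= -mulr_sumr -/(sqdist c x) sumr_const card_ord.
have -> : sqdist c x `^ (a - 1) = sqdist c x `^ (a - 2) * sqdist c x.
  rewrite -[X in _ = _ * X](powRr1 (ltW q0)) -powRD.
    by congr (_ `^ _); ring.
  by rewrite (gt_eqF q0) implybT.
rewrite -mulr_natr; ring.
Qed.

(** * The weak maximum principle *)

Lemma weak_maximum_principle (R : realType) (m : nat) (Om : set 'rV[R]_m.+1)
    (f : 'rV[R]_m.+1 -> R) (b : R) :
  open Om -> compact (closure Om) -> {within closure Om, continuous f} ->
  (forall x i, Om x ->
    derivable f x (delta_mx 0 i) /\ derivable (partial i f) x (delta_mx 0 i)) ->
  (forall x, Om x -> 0 <= laplacian f x) ->
  (forall x, (closure Om `\` Om) x -> f x <= b) ->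
  forall x, Om x -> f x <= b.
Proof.
move=> oOm cOm cf df lf fb x0 Ox0; rewrite leNgt; apply/negP => fx0.
have Ocl : Om `<=` closure Om by exact: subset_closure.
have ne : closure Om !=set0 by exists x0; exact: Ocl.
have [pB _ HB] := compact_EVT_max ne cOm
  (continuous_subspaceT (@sqdist_continuous R m.+1 0)).
set B := sqdist 0 pB in HB.
have B0 : 0 <= B by exact: sqdist_ge0.
(* Chosen to make [d * B] smaller than the excess of [f x0] over [b]; the [+ 1] keeps the
   denominator positive when [B] is 0. *)
pose d := (f x0 - b) / (2 * (B + 1)).
have d0 : 0 < d by rewrite divr_gt0 ?subr_gt0// mulr_gt0// ltr_wpDl.
have dB : d * B < f x0 - b.
  rewrite /d mulrAC ltr_pdivrMr; last by rewrite mulr_gt0// ltr_wpDl.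
  rewrite ltr_pM2l ?subr_gt0//; lra.
(* The perturbation d |y|^2 makes the Laplacian positive, which no interior
   maximum allows, and is too small to move the maximum to the boundary. *)
pose w y := f y + d * sqdist 0 y.
have cw : {within closure Om, continuous w}.
  move=> y; apply: cvgD; first exact: cf.
  apply: cvgM; first exact: cvg_cst.
  exact: (continuous_subspaceT (@sqdist_continuous R m.+1 0)).
have [p pcl Hp] := compact_EVT_max ne cOm cw.
have wx0 : f x0 <= w p.
  apply: le_trans (Hp x0 _); last by rewrite inE; exact: Ocl.
  by rewrite /w lerDl mulr_ge0 ?sqdist_ge0 ?ltW.
(* Off [Om] one would have [w p <= b + d * B < f x0], against [wx0]. *)
have pOm : Om p.
  apply: contrapT => pn.
  have fp : f p <= b by apply: fb; split => //; rewrite inE in pcl.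
  have qp : d * sqdist 0 p <= d * B by apply: ler_wpM2l; [exact: ltW|exact: HB].
  move: wx0; rewrite /w; lra.
have nOm : \forall y \near p, Om y by exact: open_nbhs_nbhs.
have H i : partial i (partial i f) p + d * 2 <= 0.
  have qd y : derivable (sqdist 0) y (delta_mx 0 i : 'rV[R]_m.+1).
    by have [] := is_derive_sqdist 0 y (delta_mx 0 i : 'rV[R]_m.+1).
  have [qdd qddE] := is_derive_partial_sqdist i 0 p.
  have fd : \forall y \near p, derivable f y (delta_mx 0 i).
    by apply: filterS nOm => y Oy; exact: (df y i Oy).1.
  have qnd : \forall y \near p, derivable (sqdist 0) y (delta_mx 0 i : 'rV[R]_m.+1).
    by apply: (@filterE _ (nbhs p)); exact: qd.
  have [wdd wddE] := is_derive2_addZ d fd qnd (df p i pOm).2 qdd.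
  move: wddE; rewrite -/(partial i _) qddE => <-.
  have wd : \forall y \near p, derivable w y (delta_mx 0 i).
    apply: filterS nOm => y Oy.
    by have [] := is_derive_addZ d (derivableP (df y i Oy).1) (derivableP (qd y)).
  have wp : \forall y \near p, w y <= w p.
    by apply: filterS nOm => y Oy; apply: Hp; rewrite inE; exact: Ocl.
  exact: (second_derivative_le0 wd wdd wp).
(* The sum is the Laplacian of [f] at [p], which is nonnegative, plus the positive number 2 d (m +
   1). *)
have : \sum_(i < m.+1) (partial i (partial i f) p + d * 2) <= 0.
  by apply: sumr_le0.
rewrite big_split/= -/(laplacian f p) leNgt.
by rewrite ltr_wpDl ?lf// sumr_const card_ord pmulrn_lgt0// mulr_gt0.
Qed.

(** * Solutions of the Laplace equation and their combinations *)

(** Weaker than [harmonic_on]: it records exactly the regularity that the maximum principle asks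
    for, and passes to linear combinations without any mixed derivatives. *)
Definition solves_laplace (R : realType) (m : nat) (Om : set 'rV[R]_m)
    (f : 'rV[R]_m -> R) : Prop :=
  forall x, Om x -> laplacian f x = 0 /\ forall i,
    derivable f x (delta_mx 0 i) /\ derivable (partial i f) x (delta_mx 0 i).

Lemma harmonic_solves_laplace (R : realType) (m : nat) (Om : set 'rV[R]_m)
    (f : 'rV[R]_m -> R) : harmonic_on Om f -> solves_laplace Om f.
Proof.
move=> [f2 f0] x Ox; split; first exact: f0.
by move=> i; have [_ [d1 d2]] := f2 x Ox; split; [exact: (d1 i).1|exact: (d2 i i).1].
Qed.

Lemma solves_laplace0 (R : realType) (m : nat) (Om : set 'rV[R]_m) :
  solves_laplace Om (cst 0).
Proof.
have p0 (i : 'I_m) : partial i (cst 0 : 'rV[R]_m -> R) = cst 0.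
  by apply/funext => y; rewrite /partial; exact: (@derive_cst R _ R^o).
move=> x _; split.
  by rewrite /laplacian big1// => i _; rewrite !p0.
by move=> i; rewrite p0; split; exact: (@derivable_cst R _ R^o).
Qed.

Lemma solves_laplace_addZ (R : realType) (m : nat) (Om : set 'rV[R]_m)
    (f g : 'rV[R]_m -> R) (k : R) :
  open Om -> solves_laplace Om f -> solves_laplace Om g ->
  solves_laplace Om (fun y => f y + k * g y).
Proof.
move=> oOm hf hg x Ox.
have nOm : \forall y \near x, Om y by exact: open_nbhs_nbhs.
have D i : is_derive x (delta_mx 0 i) (partial i (fun y => f y + k * g y))
    (partial i (partial i f) x + k * partial i (partial i g) x).
  apply: is_derive2_addZ.
  - by apply: filterS nOm => y Oy; exact: ((hf y Oy).2 i).1.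
  - by apply: filterS nOm => y Oy; exact: ((hg y Oy).2 i).1.
  - exact: ((hf x Ox).2 i).2.
  - exact: ((hg x Ox).2 i).2.
have E : laplacian f x + k * laplacian g x = 0.
  by rewrite (hf x Ox).1 (hg x Ox).1 mulr0 addr0.
split.
  rewrite /laplacian; under eq_bigr => i _.
    rewrite {1}/partial; have [_ ->] := D i; over.
  rewrite big_split -mulr_sumr; exact: E.
move=> i; split; last by case: (D i).
by case: (is_derive_addZ k (derivableP ((hf x Ox).2 i).1)
  (derivableP ((hg x Ox).2 i).1)).
Qed.

(** The function is |y - c|^-n, the harmonic power in dimension n + 2: the factor n + 2 + 2 (- n / 2
    - 1) of its Laplacian is 0. *)
Lemma solves_laplace_powR_sqdist (R : realType) (n : nat) (Om : set 'rV[R]_n.+2)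
    (c : 'rV[R]_n.+2) : (forall x, Om x -> 0 < sqdist c x) ->
  solves_laplace Om (fun y => sqdist c y `^ (- (n%:R / 2))).
Proof.
move=> q0 x /q0 qx; split.
  rewrite laplacian_powR_sqdist// (_ : n.+2%:R + _ = 0) ?mulr0 ?mul0r//.
  rewrite -addn2 natrD; lra.
move=> i; split.
  by case: (is_derive_powR_sqdist (delta_mx 0 i) (- (n%:R / 2)) qx).
by case: (is_derive_partial_powR_sqdist i (- (n%:R / 2)) qx).
Qed.

Lemma continuous_powR_sqdist (R : realType) (m : nat) (c x : 'rV[R]_m) (a : R) :
  0 < sqdist c x -> {for x, continuous (fun y => sqdist c y `^ a)}.
Proof.
move=> q0.
have h : {for sqdist c x, continuous (fun y : R => y `^ a)}.
  apply: differentiable_continuous; apply/derivable1_diffP.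
  by case: (is_derive1_powR a q0).
exact: (continuous_comp (@sqdist_continuous R m c x) h).
Qed.

(** * Euclidean balls: closure, boundary and compactness *)

Lemma eballE (R : realType) (m : nat) (c : 'rV[R]_m) (r : R) : 0 < r ->
  eball c r = [set x | sqdist c x < r ^+ 2].
Proof.
move=> r0.
have E x : (Num.sqrt (sqdist c x) < r) = (sqdist c x < r ^+ 2).
  rewrite -[in RHS](sqr_sqrtr (sqdist_ge0 c x)) ltr_pXn2r//.
    by rewrite nnegrE sqrtr_ge0.
  by rewrite nnegrE ltW.
by apply/seteqP; split => x; rewrite /eball /= enormE E.
Qed.

Lemma open_sqdist_lt (R : realType) (m : nat) (c : 'rV[R]_m) (b : R) :
  open [set x | sqdist c x < b].
Proof.
have /continuousP h := @sqdist_continuous R m c.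
exact: (h _ (open_lt (y := b))).
Qed.

Lemma closed_sqdist_le (R : realType) (m : nat) (c : 'rV[R]_m) (b : R) :
  closed [set x | sqdist c x <= b].
Proof.
have /continuous_closedP h := @sqdist_continuous R m c.
exact: (h _ (closed_le (y := b))).
Qed.

Lemma closed_sqdist_ge (R : realType) (m : nat) (c : 'rV[R]_m) (b : R) :
  closed [set x | b <= sqdist c x].
Proof.
have /continuous_closedP h := @sqdist_continuous R m c.
exact: (h _ (closed_ge (y := b))).
Qed.

Lemma closure_eball_le (R : realType) (m : nat) (c x : 'rV[R]_m) (r : R) :
  0 < r -> closure (eball c r) x -> sqdist c x <= r ^+ 2.
Proof.
move=> r0; rewrite eballE// => h.
apply: (@closed_sqdist_le R m c (r ^+ 2)).
by apply: closure_subset h => y /ltW.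
Qed.

Lemma boundary_eball (R : realType) (m : nat) (c x : 'rV[R]_m) (r : R) :
  0 < r -> boundary (eball c r) x -> sqdist c x = r ^+ 2.
Proof.
move=> r0 [xc xi]; apply/eqP; rewrite eq_le closure_eball_le//=.
rewrite leNgt; apply/negP => h; apply: xi.
rewrite eballE//; apply: open_nbhs_nbhs; split => //.
exact: open_sqdist_lt.
Qed.

(** Each coordinate is bounded by [|r|], so [A] is a closed subset of a compact cube. *)
Lemma sqdist_compact (R : realType) (m : nat) (r : R) (A : set 'rV[R]_m) :
  closed A -> (forall x, A x -> sqdist 0 x <= r ^+ 2) -> compact A.
Proof.
move=> cA Ar.
have cb : compact [set v : 'rV[R]_m | forall i, `[- `|r|, `|r|]%classic (v ord0 i)].
  apply: (@rV_compact R m (fun=> `[- `|r|, `|r|]%classic)).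
  by move=> _; exact: segment_compact.
apply: (subclosed_compact cA cb) => x /Ar xr i /=.
rewrite in_itv/= -ler_norml -ler_sqr ?nnegrE// !real_normK ?num_real//.
apply: le_trans xr; rewrite /sqdist (bigD1 i)//= mxE subr0 lerDl.
by apply: sumr_ge0 => j _; exact: sqr_ge0.
Qed.

(** * Elementary inequalities for the barrier *)

(** Induction on [n]. If the new factor 1 - (n + 1) s is not positive, the left side is at most 0;
    otherwise 1 - n s is positive too, and multiplying by it makes the induction hypothesis
    applicable. *)
Lemma pow_mul_one_sub_le (R : realFieldType) (n : nat) (s : R) : 0 <= s ->
  (1 + 2 * s) ^+ n.+1 * (1 - n%:R * s) <= 1 + (n%:R + 2) * s.
Proof.
move=> s0; elim: n => [|n IH]; first by rewrite expr1; lra.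
have n0 : 0 <= n%:R :> R by exact: ler0n.
rewrite -(natr1 n) in IH *; set N : R := n%:R in n0 IH *.
have Ns : 0 <= N * s by exact: mulr_ge0.
have X0 : 0 <= (1 + 2 * s) ^+ n.+2 by apply: exprn_ge0; lra.
have [neg|pos] := lerP (1 - (N + 1) * s) 0.
  apply: (@le_trans _ _ 0); first by rewrite mulr_ge0_le0.
  nra.
have pos' : 0 < 1 - N * s by lra.
rewrite -(ler_pM2r pos').
set X := (1 + 2 * s) ^+ n.+1 in IH X0 *.
apply: (@le_trans _ _ ((1 + 2 * s) * (1 - (N + 1) * s) * (1 + (N + 2) * s))).
  rewrite [(1 + 2 * s) ^+ n.+2]exprS -/X.
  rewrite (_ : _ * X * _ * _ = (1 + 2 * s) * (1 - (N + 1) * s) * (X * (1 - N * s))).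
    by apply: ler_wpM2l => //; apply: mulr_ge0; lra.
  by ring.
rewrite -subr_ge0 (_ : _ - _ = 2 * (N + 1) * (N + 2) * s ^+ 3); last by ring.
by rewrite !mulr_ge0 ?exprn_ge0//; lra.
Qed.

(** The extreme case |x - t e1| = 2 r2 - r1. Substituting r2 = r1 (1 + s) and clearing denominators
    leaves exactly [pow_mul_one_sub_le]. *)
Lemma barrier_constant_le (R : realFieldType) (n : nat) (r1 r2 : R) :
  0 < r1 -> r1 < r2 ->
  (((n%:R + 1) * r1 - n%:R * r2) / (2 * r2 * (r2 - r1)))
    * (((2 * r2 - r1) / r1) ^+ n - 1) <= n%:R / (2 * r2 - r1).
Proof.
move=> r10 r12; pose s := (r2 - r1) / r1.
have s0 : 0 < s by rewrite divr_gt0// subr_gt0.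
have n0 : 0 <= n%:R :> R by exact: ler0n.
have E2 : r2 = r1 * (1 + s) by rewrite /s; field; rewrite gt_eqF.
have := pow_mul_one_sub_le n (ltW s0).
rewrite E2; move: s s0 {E2} => s s0.
rewrite (_ : (2 * (r1 * (1 + s)) - r1) / r1 = 1 + 2 * s); last first.
  by field; rewrite gt_eqF.
rewrite exprS; set X := (1 + 2 * s) ^+ n; set N : R := n%:R in n0 * => H.
rewrite (_ : ((N + 1) * r1 - _) / _ = (1 - N * s) / (2 * (r1 * (1 + s)) * s)); last first.
  have s1 : 0 < 1 + s by lra.
  have rs : 0 < r1 * (1 + s) - r1.
    by rewrite mulrDr mulr1 addrAC subrr add0r mulr_gt0.
  by field; rewrite !gt_eqF.
rewrite (_ : 2 * (r1 * (1 + s)) - r1 = r1 * (1 + 2 * s)); last by ring.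
have d1 : 0 < 2 * (r1 * (1 + s)) * s by rewrite !mulr_gt0//; lra.
have d2 : 0 < r1 * (1 + 2 * s) by rewrite !mulr_gt0//; lra.
rewrite mulrAC ler_pdivrMr// mulrAC ler_pdivlMr//.
rewrite -subr_ge0 (_ : _ - _ = r1 * (1 + (N + 2) * s - (1 + 2 * s) * X * (1 - N * s))).
  by apply: mulr_ge0; [exact: ltW|rewrite subr_ge0].
ring.
Qed.

(** With [rho] = |x - t e1| for x on the outer sphere, this is the inequality between the constant
    times h and the outward derivative of h. Dividing by rho^-n leaves factors that are monotone in
    [rho]. *)
Lemma barrier_boundary_le (R : realFieldType) (n : nat) (r1 r2 t rho : R) :
  0 < r1 -> 0 <= t -> t < r2 - r1 -> r1 <= rho -> rho <= r2 + t ->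
  (((n%:R + 1) * r1 - n%:R * r2) / (2 * r2 * (r2 - r1)))
    * ((r1 ^+ n)^-1 - (rho ^+ n)^-1)
  <= n%:R * ((rho ^+ n)^-1 / rho ^+ 2) * ((rho ^+ 2 + r2 ^+ 2 - t ^+ 2) / (2 * r2)).
Proof.
move=> r10 t0 tr r1rho rhot.
have r12 : r1 < r2 by lra.
have rho0 : 0 < rho by lra.
have n0 : 0 <= n%:R :> R by exact: ler0n.
have := barrier_constant_le n r10 r12.
set C := (_ / (2 * r2 * (r2 - r1))) => HC.
have P0 : 0 < rho ^+ n by exact: exprn_gt0.
have Q0 : 0 < r1 ^+ n by exact: exprn_gt0.
rewrite (_ : (r1 ^+ n)^-1 - _ = (rho ^+ n)^-1 * ((rho / r1) ^+ n - 1)); last first.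
  by rewrite expr_div_n; field; rewrite !gt_eqF.
rewrite (_ : n%:R * _ * _ = (rho ^+ n)^-1
  * (n%:R * ((rho ^+ 2 + r2 ^+ 2 - t ^+ 2) / (2 * r2 * rho ^+ 2)))); last first.
  field; rewrite !gt_eqF//; lra.
rewrite mulrCA ler_pM2l ?invr_gt0//.
have d0 : 0 < 2 * r2 - r1 by lra.
(* The fraction decreases in [rho], and at [rho = r2 + t] it equals 1 / (r2 + t), where r2 + t < 2
   r2 - r1. *)
have lower : n%:R / (2 * r2 - r1)
    <= n%:R * ((rho ^+ 2 + r2 ^+ 2 - t ^+ 2) / (2 * r2 * rho ^+ 2)).
  apply: ler_wpM2l => //.
  rewrite ler_pdivlMr; last by rewrite !mulr_gt0 ?exprn_gt0//; lra.
  rewrite mulrC ler_pdivrMr//.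
  have h1 : rho ^+ 2 <= (r2 + t) ^+ 2 by rewrite ler_pXn2r ?nnegrE//; lra.
  have h2 : (r2 - t) * rho ^+ 2 <= (r2 - t) * (r2 + t) ^+ 2.
    by apply: ler_wpM2l => //; lra.
  have h3 : 0 <= (2 * r2 - r1 - (r2 + t)) * (rho ^+ 2 + (r2 - t) * (r2 + t)).
    by apply: mulr_ge0; [lra|apply: addr_ge0; [exact: sqr_ge0|apply: mulr_ge0; lra]].
  move: h2 h3; lra.
(* For [C <= 0] the two sides have opposite signs; only for [C > 0] does enlarging [rho] to 2 r2 -
   r1 enlarge the left side. *)
have [C0|C0] := lerP C 0.
  apply: (@le_trans _ _ 0).
    apply: mulr_le0_ge0 => //; rewrite subr_ge0 exprn_ege1//.
    by rewrite ler_pdivlMr// mul1r.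
  by apply: le_trans lower; apply: divr_ge0 => //; exact: ltW.
apply: le_trans lower; apply: le_trans HC.
apply: ler_wpM2l; first exact: ltW.
rewrite lerD2r; apply: lerXn2r; rewrite ?nnegrE.
- by apply: divr_ge0; exact: ltW.
- by apply: divr_ge0; exact: ltW.
- by rewrite ler_pM2r ?invr_gt0//; lra.
Qed.

(** * Geometry of the eccentric annulus *)

Lemma sqdist_axis (R : realType) (n : nat) (t : R) (x : 'rV[R]_n.+2) :
  sqdist (t *: delta_mx 0 0) x = sqdist 0 x - 2 * t * x 0 0 + t ^+ 2.
Proof.
rewrite /sqdist (bigD1 (0 : 'I_n.+2))//= [in RHS](bigD1 (0 : 'I_n.+2))//= !mxE/= subr0 mulr1.
under eq_bigr => i /negPf i0 do rewrite !mxE eqxx i0/= mulr0.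
under [in RHS]eq_bigr => i _ do rewrite mxE.
ring.
Qed.

Lemma radial_axis (R : realType) (n : nat) (t : R) (x : 'rV[R]_n.+2) :
  \sum_(i < n.+2) (x 0 i - (t *: delta_mx 0 0 : 'rV[R]_n.+2) 0 i) * x 0 i
    = sqdist 0 x - t * x 0 0.
Proof.
rewrite /sqdist (bigD1 (0 : 'I_n.+2))//= [in RHS](bigD1 (0 : 'I_n.+2))//= !mxE/= subr0 mulr1.
under eq_bigr => i /negPf i0 do rewrite !mxE eqxx i0/= mulr0 subr0 -expr2.
under [in RHS]eq_bigr => i _ do rewrite mxE subr0.
ring.
Qed.

Lemma sqdist0Z (R : realType) (m : nat) (k : R) (x : 'rV[R]_m) :
  sqdist 0 (k *: x) = k ^+ 2 * sqdist 0 x.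
Proof.
rewrite /sqdist mulr_sumr; apply: eq_bigr => i _.
by rewrite !mxE !subr0 exprMn.
Qed.

(** By the law of cosines [sqdist_axis] only the first coordinate matters; it ranges over [-r, r],
    and the bounds are the values at its ends. *)
Lemma sqdist_axis_sphere (R : realType) (n : nat) (r t : R) (x : 'rV[R]_n.+2) :
  0 <= t -> 0 <= r -> sqdist 0 x = r ^+ 2 ->
  (r - t) ^+ 2 <= sqdist (t *: delta_mx 0 0) x <= (r + t) ^+ 2.
Proof.
move=> t0 r0 xr.
have : `|x 0 0| <= r.
  rewrite -[leRHS](ger0_norm r0) -ler_sqr ?nnegrE// !real_normK ?num_real//.
  rewrite -xr /sqdist (bigD1 (0 : 'I_n.+2))//= mxE subr0 lerDl.
  by apply: sumr_ge0 => j _; exact: sqr_ge0.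
rewrite ler_norml sqdist_axis xr => /andP[h1 h2].
have h3 : 0 <= t * (r - x 0 0) by apply: mulr_ge0; lra.
have h4 : 0 <= t * (r + x 0 0) by apply: mulr_ge0; lra.
apply/andP; split; move: h3 h4; lra.
Qed.

Lemma open_annulus (R : realType) (n : nat) (r1 r2 t : R) : 0 < r2 ->
  open (@annulus R n r1 r2 t).
Proof.
move=> r20; rewrite /annulus setDE; apply: openI; last first.
  by apply: closed_openC; exact: closed_closure.
rewrite /outer_ball eballE//; exact: open_sqdist_lt.
Qed.

Lemma annulusI (R : realType) (n : nat) (r1 r2 t : R) (x : 'rV[R]_n.+2) :
  0 < r1 -> 0 < r2 -> sqdist 0 x < r2 ^+ 2 ->
  r1 ^+ 2 < sqdist (t *: delta_mx 0 0) x -> @annulus R n r1 r2 t x.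
Proof.
move=> r10 r20 x2 x1; split; first by rewrite /outer_ball eballE.
by move=> /(closure_eball_le r10); rewrite leNgt x1.
Qed.

Lemma closure_annulus_ge (R : realType) (n : nat) (r1 r2 t : R)
    (x : 'rV[R]_n.+2) : 0 < r1 -> closure (@annulus R n r1 r2 t) x ->
  r1 ^+ 2 <= sqdist (t *: delta_mx 0 0) x.
Proof.
move=> r10 h.
apply: (@closed_sqdist_ge R n.+2 (t *: delta_mx 0 0) (r1 ^+ 2)).
apply: closure_subset h => y [_ yn] /=; rewrite leNgt; apply/negP => yl.
by apply: yn; apply: subset_closure; rewrite /inner_ball eballE.
Qed.

Lemma closure_annulus_le (R : realType) (n : nat) (r1 r2 t : R)
    (x : 'rV[R]_n.+2) : 0 < r2 -> closure (@annulus R n r1 r2 t) x ->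
  sqdist 0 x <= r2 ^+ 2.
Proof.
move=> r20 h; apply: closure_eball_le => //.
by apply: closure_subset h => y [].
Qed.

(** A limit point strictly inside the outer ball but outside the annulus lies in the closure of the
    inner ball; it is not interior there, since the inner ball misses the annulus. *)
Lemma closure_annulusD (R : realType) (n : nat) (r1 r2 t : R)
    (x : 'rV[R]_n.+2) : 0 < r2 ->
  (closure (@annulus R n r1 r2 t) `\` @annulus R n r1 r2 t) x ->
  sqdist 0 x = r2 ^+ 2 \/ boundary (@inner_ball R n r1 t) x.
Proof.
move=> r20 [xc xn].
have := closure_annulus_le r20 xc.
rewrite le_eqVlt => /predU1P[->|xr]; [by left|right].
split.
  apply: contrapT => h; apply: xn; split => //.
  by rewrite /outer_ball eballE.
move=> xi; have [y [[_ yn] yi]] := xc _ xi.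
by apply: yn; exact: subset_closure.
Qed.

(** Makes bounds in the annulus available to [has_normal_derivative], which looks along this ray.
    Moving inward shrinks the norm, and the distance to the inner centre starts at no less than r2 -
    t > r1. *)
Lemma sphere_near_annulus (R : realType) (n : nat) (r1 r2 t : R)
    (x : 'rV[R]_n.+2) : 0 < r1 -> 0 <= t -> t < r2 - r1 ->
  sqdist 0 x = r2 ^+ 2 ->
  \forall s \near 0^'+, @annulus R n r1 r2 t (x - s *: (r2^-1 *: x)).
Proof.
move=> r10 t0 tr xr.
have r20 : 0 < r2 by lra.
have /andP[xc _] := sqdist_axis_sphere t0 (ltW r20) xr.
have r1x : r1 ^+ 2 < sqdist (t *: delta_mx 0 0) x.
  by apply: lt_le_trans xc; rewrite ltr_pXn2r ?nnegrE//; lra.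
have line : (fun s : R => x - s *: (r2^-1 *: x)) @ 0^'+ --> x.
  apply: cvg_at_right_filter.
  rewrite -[X in _ --> X]subr0 -(scale0r (r2^-1 *: x)).
  by apply: cvgB; [exact: cvg_cst|exact: scalel_continuous].
have N1 := line _ (near_sqdist_gt r1x).
near=> s.
have s0 : 0 < s by [].
have sr : s < r2 by near: s; exact: nbhs_right_lt.
apply: annulusI => //; last by near: s.
rewrite scalerA -[X in X - _](scale1r x) -scalerBl sqdist0Z xr.
rewrite gtr_pMl ?exprn_gt0// expr_lt1 ?expr_gt0//.
  by rewrite ltrBlDr ltrDl divr_gt0.
by rewrite subr_ge0 ler_pdivrMr// mul1r ltW.
Unshelve. all: by end_near. Qed.

Lemma sphere_closure_annulus (R : realType) (n : nat) (r1 r2 t : R)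
    (x : 'rV[R]_n.+2) : 0 < r1 -> 0 <= t -> t < r2 - r1 ->
  sqdist 0 x = r2 ^+ 2 -> closure (@annulus R n r1 r2 t) x.
Proof.
move=> r10 t0 tr xr B Bx.
have line : (fun s : R => x - s *: (r2^-1 *: x)) @ 0^'+ --> x.
  apply: cvg_at_right_filter.
  rewrite -[X in _ --> X]subr0 -(scale0r (r2^-1 *: x)).
  by apply: cvgB; [exact: cvg_cst|exact: scalel_continuous].
have h := @filterI _ (0:R)^'+ _ _ _ (sphere_near_annulus r10 t0 tr xr) (line _ Bx).
by have [s hs] := filter_ex (h _); exists (x - s *: (r2^-1 *: x)).
Qed.

Lemma sphere_boundary (R : realType) (n : nat) (r1 r2 t : R)
    (x : 'rV[R]_n.+2) : 0 < r1 -> 0 <= t -> t < r2 - r1 ->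
  sqdist 0 x = r2 ^+ 2 -> boundary (@outer_ball R n r2) x.
Proof.
move=> r10 t0 tr xr; split.
  by apply: closure_subset (sphere_closure_annulus r10 t0 tr xr) => y [].
have r20 : 0 < r2 by lra.
by move=> /interior_subset; rewrite /outer_ball eballE//= xr ltxx.
Qed.

(** * The fundamental solution on the outer sphere *)

Lemma powR_sqr_half (R : realType) (n : nat) (rho : R) : 0 < rho ->
  (rho ^+ 2) `^ (- (n%:R / 2)) = (rho ^+ n)^-1.
Proof.
move=> r0; rewrite -(powR_mulrn 2 (ltW r0)) -powRrM mulrN mulrCA divff//.
by rewrite mulr1 powRN powR_mulrn// ltW.
Qed.

Lemma compact_sphere (R : realType) (m : nat) (r : R) :
  compact [set x : 'rV[R]_m | sqdist 0 x = r ^+ 2].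
Proof.
apply: (@sqdist_compact R m r); last by move=> x /= ->.
rewrite (_ : mkset _ = [set x | sqdist 0 x <= r ^+ 2] `&` [set x | r ^+ 2 <= sqdist 0 x]).
  apply: closedI; [exact: closed_sqdist_le|exact: closed_sqdist_ge].
apply/seteqP; split => x /=; first by move=> ->; rewrite lexx.
by move=> [h1 h2]; apply/eqP; rewrite eq_le h1.
Qed.

(** The one-sided outward derivative is minus the directional derivative along the inward normal. *)
Lemma normal_derivative_fundamental (R : realType) (n : nat) (r t : R)
    (x : 'rV[R]_n.+2) : 0 < r -> sqdist 0 x = r ^+ 2 ->
  0 < sqdist (t *: delta_mx 0 0) x ->
  has_normal_derivative (fun y => sqdist (t *: delta_mx 0 0) y `^ (- (n%:R / 2)))
    x (r^-1 *: x)
    (- (n%:R * sqdist (t *: delta_mx 0 0) x `^ (- (n%:R / 2) - 1)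
       * ((sqdist (t *: delta_mx 0 0) x + r ^+ 2 - t ^+ 2) / (2 * r)))).
Proof.
move=> r0 xr q0.
have [dF FE] := is_derive_powR_sqdist (- (r^-1 *: x)) (- (n%:R / 2)) q0.
set F := fun y => _ in dF FE *; set q := sqdist _ x in q0 FE *.
(* The inner product of x - t e1 with x is r^2 - t x_1, which the law of cosines expresses through
   [q]. *)
have E : \sum_(i < n.+2) (x 0 i - (t *: delta_mx 0 0 : 'rV[R]_n.+2) 0 i)
      * (- (r^-1 *: x)) 0 i = - ((q + r ^+ 2 - t ^+ 2) / (2 * r)).
  rewrite (eq_bigr (fun i => (- r^-1)
      * ((x 0 i - (t *: delta_mx 0 0 : 'rV[R]_n.+2) 0 i) * x 0 i))); last first.
    by move=> i _; rewrite !mxE; ring.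
  rewrite -mulr_sumr radial_axis /q sqdist_axis xr; field.
  by rewrite gt_eqF.
rewrite E in FE.
have cF : h^-1 *: ((F \o shift x) (h *: - (r^-1 *: x)) - F x) @[h --> 0^'+]
    --> 'D_(- (r^-1 *: x)) F x by exact: cvg_dnbhs_at_right.
rewrite /has_normal_derivative.
rewrite (_ : - _ = - 'D_(- (r^-1 *: x)) F x); last by rewrite FE; field; rewrite gt_eqF.
have Eq s : (F x - F (x - s *: (r^-1 *: x))) / s
    = - (s^-1 * (F (s *: - (r^-1 *: x) + x) - F x)).
  by rewrite scalerN [- _ + x]addrC -mulrN opprB mulrC.
apply: cvg_trans (cvgN cF); apply: near_eq_cvg; apply: nearW => s.
exact: esym (Eq s).
Qed.

(** * The comparison argument and the bound for every eigenvalue *)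

Lemma eigenvalue_ge_of_gt0 (R : realType) (n : nat) (r1 r2 t sigma : R)
    (u : 'rV[R]_n.+2 -> R) (x0 : 'rV[R]_n.+2) :
  (0 < n)%N -> 0 < r1 -> 0 <= t -> t < r2 - r1 ->
  {within closure (annulus r1 r2 t), continuous u} ->
  solves_laplace (annulus r1 r2 t) u ->
  (forall x, boundary (inner_ball r1 t) x -> u x = 0) ->
  (forall x, boundary (outer_ball r2) x ->
     has_normal_derivative u x ((enorm x)^-1 *: x) (sigma * u x)) ->
  sqdist 0 x0 = r2 ^+ 2 -> 0 < u x0 ->
  ((n%:R + 1) * r1 - n%:R * r2) / (2 * r2 * (r2 - r1)) <= sigma.
Proof.
set C := _ / _.
move=> n0 r10 t0 tr cu hu ui un x0r ux0.
have r20 : 0 < r2 by lra.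
have r120 : 0 < r1 ^+ 2 by exact: exprn_gt0.
set c : 'rV[R]_n.+2 := t *: delta_mx 0 0.
pose F (y : 'rV[R]_n.+2) : R := sqdist c y `^ (- (n%:R / 2)).
(* [K] is the value of [F] on the inner sphere, so the barrier h is [K - F], and u <= M h reads
   [u + M * F <= M * K]. *)
pose K : R := (r1 ^+ n)^-1.
pose S := [set x : 'rV[R]_n.+2 | sqdist 0 x = r2 ^+ 2].
have oOm : open (annulus r1 r2 t : set 'rV[R]_n.+2) by exact: open_annulus.
have Scl : S `<=` closure (annulus r1 r2 t).
  by move=> x xS; exact: sphere_closure_annulus.
have qcl x : closure (annulus r1 r2 t) x -> 0 < sqdist c x.
  by move=> /(closure_annulus_ge r10); exact: lt_le_trans.
have huF M : solves_laplace (annulus r1 r2 t) (fun y => u y + M * F y).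
  have hF : solves_laplace (annulus r1 r2 t) F.
    by apply: solves_laplace_powR_sqdist => x Ox; exact/qcl/subset_closure.
  exact: (solves_laplace_addZ M oOm hu hF).
have cF : {within closure (annulus r1 r2 t), continuous F}.
  apply: continuous_in_subspaceT => x /[1!inE] /qcl.
  exact: continuous_powR_sqdist.
have SF x : S x -> F x < K /\
    C * (K - F x) <= n%:R * sqdist c x `^ (- (n%:R / 2) - 1)
       * ((sqdist c x + r2 ^+ 2 - t ^+ 2) / (2 * r2)).
  move=> xS; have /andP[] := sqdist_axis_sphere t0 (ltW r20) xS.
  (* Writing the squared distance as [rho ^+ 2] turns the real powers into the natural powers of
     [barrier_boundary_le]. *)
  rewrite -/c /F; move: (sqdist_ge0 c x) => /sqr_sqrtr <-.
  set rho := Num.sqrt _ => q1 q2.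
  have rho_ge0 : 0 <= rho by exact: sqrtr_ge0.
  have r1rho : r1 < rho.
    have : r2 - t <= rho by rewrite ler_pXn2r ?nnegrE// in q1; lra.
    lra.
  have rho0 : 0 < rho by lra.
  have rhor : rho <= r2 + t by rewrite ler_pXn2r ?nnegrE// in q2; lra.
  rewrite powRD ?(gt_eqF (exprn_gt0 2 rho0)) ?implybT//.
  rewrite powR_inv1 ?sqr_ge0// powR_sqr_half//; split.
    by rewrite ltf_pV2 ?posrE ?exprn_gt0// ltr_pXn2r ?nnegrE// ?ltW.
  exact: (barrier_boundary_le n r10 t0 tr (ltW r1rho) rhor).
have cuF : {within S, continuous (fun y => u y / (K - F y))}.
  have cuS := continuous_subspaceW Scl cu.
  have cFS := continuous_subspaceW Scl cF.
  rewrite continuous_subspace_in => x xS; apply: cvgM; first exact: cuS.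
  apply: cvgV; last by apply: cvgB; [exact: cvg_cst|exact: cFS].
  rewrite inE in xS.
  by have [Fx _] := SF x xS; rewrite subr_eq0 gt_eqF.
have [p pS Hp] := compact_EVT_max (ex_intro _ _ x0r) (@compact_sphere _ _ r2) cuF.
rewrite inE in pS.
set M := u p / (K - F p) in Hp.
have [Fp Cp] := SF p pS.
have KF x : S x -> 0 < K - F x by move=> /SF []; rewrite subr_gt0.
have M0 : 0 < M.
  apply: lt_le_trans (Hp x0 _); last by rewrite inE.
  by rewrite divr_gt0// KF.
have uM x : S x -> u x <= M * (K - F x).
  by move=> xS; rewrite -ler_pdivrMr ?KF// Hp// inE.
have upE : u p = M * (K - F p) by rewrite /M divfK// gt_eqF// KF.
have bound x : annulus r1 r2 t x -> u x + M * F x <= M * K.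
  move: x; apply: weak_maximum_principle.
  - exact: open_annulus.
  - apply: (@sqdist_compact _ _ r2); first exact: closed_closure.
    by move=> x; exact: closure_annulus_le.
  - move=> y; apply: cvgD; first exact: cu.
    by apply: cvgM; [exact: cvg_cst|exact: cF].
  - by move=> x i Ox; have [_ h] := huF M x Ox; exact: h.
  - by move=> x Ox; have [-> _] := huF M x Ox.
  (* On the outer sphere the bound is the choice of [M]; on the inner one u = 0 and F = K give
     equality. *)
  - move=> x /(closure_annulusD r20) [xS|xb].
      have := uM x xS; lra.
    rewrite ui// add0r /F (boundary_eball r10 xb) powR_sqr_half//.
set D := n%:R * _ * _ in Cp.
have np : has_normal_derivative F p (r2^-1 *: p) (- D)
  := normal_derivative_fundamental r20 pS (qcl p (Scl p pS)).
have nup := un p (sphere_boundary r10 t0 tr pS).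
rewrite (_ : enorm p = r2) in nup; last first.
  by rewrite -[p]subr0 enormE pS sqrtr_sqr ger0_norm// ltW.
have lim : (u p - u (p - s *: (r2^-1 *: p))) / s
    + M * ((F p - F (p - s *: (r2^-1 *: p))) / s) @[s --> 0^'+]
    --> sigma * u p + M * - D.
  by apply: cvgD; [exact: nup|apply: cvgM; [exact: cvg_cst|exact: np]].
(* [u + M * F] equals [M * K] at [p] and does not exceed it at the nearby points of the inward
   normal. *)
have quot_ge0 : \forall s \near 0^'+,
    0 <= (u p - u (p - s *: (r2^-1 *: p))) / s
      + M * ((F p - F (p - s *: (r2^-1 *: p))) / s).
  near=> s.
  have s0 : 0 < s by [].
  have /bound b : annulus r1 r2 t (p - s *: (r2^-1 *: p)).
    by near: s; exact: sphere_near_annulus.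
  rewrite mulrA -mulrDl divr_ge0 ?(ltW s0)//.
  rewrite upE; move: b; lra.
have : 0 <= sigma * u p + M * - D by exact: cvgr_to_ge lim quot_ge0.
rewrite mulrN subr_ge0 => sig.
have : M * (C * (K - F p)) <= sigma * u p.
  by apply: le_trans sig; apply: ler_wpM2l; [exact: ltW|exact: Cp].
(* Since [M * (K - F p)] is [u p], the claim is [C * u p <= sigma * u p] divided by [u p > 0]. *)
rewrite mulrCA -upE ler_pM2r//.
by rewrite upE mulr_gt0// KF.
Unshelve. all: by end_near. Qed.

(** The comparison applies to [u] or to [- u] unless [u] vanishes on the outer sphere; in that case
    the maximum principle for both forces [u] to vanish in the annulus. *)
Lemma eigenvalue_ge (R : realType) (n : nat) (r1 r2 t sigma : R) :
  (0 < n)%N -> 0 < r1 -> 0 <= t -> t < r2 - r1 ->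
  sd_eigenvalue n r1 r2 t sigma ->
  ((n%:R + 1) * r1 - n%:R * r2) / (2 * r2 * (r2 - r1)) <= sigma.
Proof.
move=> n0 r10 t0 tr [u [[x1 Ox1 ux1] cu /harmonic_solves_laplace hu ui un]].
have r20 : 0 < r2 by lra.
have oOm : open (annulus r1 r2 t : set 'rV[R]_n.+2) by exact: open_annulus.
(* This is [- u], in the shape required by [solves_laplace_addZ]. *)
pose v (y : 'rV[R]_n.+2) : R := 0 + -1 * u y.
have vE y : v y = - u y by rewrite /v add0r mulN1r.
have hv : solves_laplace (annulus r1 r2 t) v.
  exact: (solves_laplace_addZ (-1) oOm (@solves_laplace0 R n.+2 _) hu).
have cv : {within closure (annulus r1 r2 t), continuous v}.
  move=> y; apply: cvgD; first exact: cvg_cst.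
  by apply: cvgM; [exact: cvg_cst|exact: cu].
have vi x : boundary (inner_ball r1 t) x -> v x = 0.
  by move=> /ui; rewrite vE => ->; rewrite oppr0.
have vn x : boundary (outer_ball r2) x ->
    has_normal_derivative v x ((enorm x)^-1 *: x) (sigma * v x).
  move=> /un /cvgN; rewrite vE mulrN /has_normal_derivative.
  have Eq (s : R) : (v x - v (x - s *: ((enorm x)^-1 *: x))) / s
      = - ((u x - u (x - s *: ((enorm x)^-1 *: x))) / s).
    by rewrite !vE -mulNr opprB opprK addrC.
  apply: cvg_trans; apply: near_eq_cvg; apply: nearW => s; exact: esym (Eq s).
have [[p pS up]|np] := pselect (exists2 p, sqdist 0 p = r2 ^+ 2 & 0 < u p).
  exact: (eigenvalue_ge_of_gt0 n0 r10 t0 tr cu hu ui un pS up).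
have [[p pS vp]|nv] := pselect (exists2 p, sqdist 0 p = r2 ^+ 2 & 0 < v p).
  exact: (eigenvalue_ge_of_gt0 n0 r10 t0 tr cv hv vi vn pS vp).
exfalso; move/eqP: ux1; apply.
have le0 (w : 'rV[R]_n.+2 -> R) :
    {within closure (annulus r1 r2 t), continuous w} ->
    solves_laplace (annulus r1 r2 t) w ->
    (forall x, boundary (inner_ball r1 t) x -> w x = 0) ->
    ~ (exists2 p, sqdist 0 p = r2 ^+ 2 & 0 < w p) -> w x1 <= 0.
  move=> cw hw wi nw; move: x1 Ox1; apply: weak_maximum_principle => //.
  - apply: (@sqdist_compact _ _ r2); first exact: closed_closure.
    by move=> x; exact: closure_annulus_le.
  - by move=> x i Ox; have [_ h] := hw x Ox; exact: h.
  - by move=> x Ox; have [-> _] := hw x Ox.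
  - move=> x /(closure_annulusD r20) [xS|/wi ->//].
    by rewrite leNgt; apply/negP => wx; apply: nw; exists x.
apply/eqP; rewrite eq_le (le0 u)//=.
by rewrite -oppr_le0 -vE le0.
Qed.

(** * Passage to the limit inferior *)

Unset Implicit Arguments.
Set Strict Implicit.

Theorem theorem1p1 (R : realType) (n : nat) (r1 r2 : R) (hn : (1 <= n)%N)
    (hr1 : 0 < r1) (hr12 : r1 < r2) :
  ((((n%:R + 1) * r1 - n%:R * r2) / (2 * r2 * (r2 - r1)))%:E
    <= limf_einf (fun t : R => first_sd_eigenvalue n r1 r2 t) (r2 - r1)^'-)%E.
Proof.
rewrite limf_einfE; apply: le_trans (ereal_sup_ubound _); last first.
  (* The limit inferior is a supremum of infima over the sets of the filter; this set belongs to it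
     because 0 < r2 - r1, and the bound is uniform on it. *)
  exists [set t : R | 0 <= t /\ t < r2 - r1]; last by reflexivity.
  have r0 : 0 < r2 - r1 by rewrite subr_gt0.
  near=> t; split; near: t; [exact: nbhs_left_ge|exact: nbhs_left_lt].
apply: le_ereal_inf_tmp => _ [t [t0 tr] <-].
apply: le_ereal_inf_tmp => _ [sigma hsigma <-].
by rewrite lee_fin; exact: eigenvalue_ge hsigma.
Unshelve. all: by end_near. Qed.
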